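(* For every $n \geqslant 3$ and every $k = 0, 1, \ldots, n$, $$c_k(S_n) = c_k(B_{n,n-1}) \leqslant c_k(B_{n,n-2}) \leqslant \cdots \leqslant c_k(B_{n,3}) \leqslant c_k(B_{n,2}) = c_k(P_n).$$
   Context: For a simple graph $G$ on $n$ vertices with Laplacian matrix $L(G) = D(G) - A(G)$, the Laplacian coefficients $c_0(G), \ldots, c_n(G)$ are defined by $\det(\lambda I_n - L(G)) = \sum_{k=0}^n (-1)^k c_k(G) \lambda^{n-k}$. $S_n$ and $P_n$ denote the star and the path on $n$ vertices. The broom $B_{n,\Delta}$ is the tree on $n$ vertices consisting of a star $S_{\Delta+1}$ (on $\Delta+1$ vertices) and a path of length $n - \Delta - 1$ attached to an arbitrary pendent vertex of the star (so $n-\Delta-1$ new vertices are added, extending that pendent vertex into a path). *)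

(* Defs.v *)
From mathcomp Require Import all_boot all_order all_algebra.

Set Implicit Arguments.
Unset Strict Implicit.
Unset Printing Implicit Defensive.

Import Order.TTheory GRing.Theory Num.Theory.
Local Open Scope ring_scope.

Record sgraph (V : finType) := SGraph {
  adj : rel V;
  adj_sym : symmetric adj;
  adj_irrefl : irreflexive adj
}.

Section Laplacian.

Variables (n : nat) (G : sgraph 'I_n).

Definition degree (i : 'I_n) : nat := #|[set j | adj G i j]|.

Definition degree_mx : 'M[int]_n := diag_mx (\row_i (degree i)%:Z).

Definition adjacency_mx : 'M[int]_n := \matrix_(i, j) (adj G i j : nat)%:Z.

Definition laplacian : 'M[int]_n := degree_mx - adjacency_mx.

(* [char_poly M] is \det ('X%:M - M). The defining expansion of the Laplacian
   coefficients is recovered in [char_poly_laplacian]. Only k <= n is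
   meaningful, since n - k is truncated. *)
Definition lapl_coef (k : nat) : int :=
  (-1) ^+ k * (char_poly laplacian)`_(n - k).

Lemma char_poly_laplacian :
  char_poly laplacian =
    \sum_(k < n.+1) ((-1) ^+ k * lapl_coef k) *: 'X^(n - k).
Proof.
rewrite -[LHS]coefK size_char_poly poly_def (reindex_inj rev_ord_inj) /=.
apply: eq_bigr => k _.
by rewrite /lapl_coef mulrA -exprMn mulrNN mulr1 expr1n mul1r subSS.
Qed.

End Laplacian.

Section GraphOfEdges.

Variables (V : finType) (r : rel V).

Definition sym_adj : rel V := fun x y => (x != y) && (r x y || r y x).

Lemma sym_adj_sym : symmetric sym_adj.
Proof. by move=> x y; rewrite /sym_adj eq_sym orbC. Qed.

Lemma sym_adj_irrefl : irreflexive sym_adj.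
Proof. by move=> x; rewrite /sym_adj eqxx. Qed.

Definition sgraph_of : sgraph V := SGraph sym_adj_sym sym_adj_irrefl.

End GraphOfEdges.

(* The center is the vertex 0. *)
Definition star (n : nat) : sgraph 'I_n :=
  sgraph_of (fun i j : 'I_n => (i == 0 :> nat) && (0 < j)%N).

Definition path_graph (n : nat) : sgraph 'I_n :=
  sgraph_of (fun i j : 'I_n => j == i.+1 :> nat).

(* The vertices 0, ..., D carry the star with center 0. The new vertices
   D + 1, ..., n - 1 form, in this order, the path attached to the pendent
   vertex p + 1, where p : 'I_D ranges over all the D choices. This is the broom
   B_{n,D} when D + 1 <= n. *)
Definition broom (n D : nat) (p : 'I_D) : sgraph 'I_n :=
  sgraph_of (fun i j : 'I_n =>
    [|| (i == 0 :> nat) && (0 < j <= D)%N,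
        (i == p.+1 :> nat) && (j == D.+1 :> nat)
      | (D < i)%N && (j == i.+1 :> nat)]).

(* Main.v *)
Require Import Defs.
From mathcomp Require Import all_boot all_order all_algebra.
From mathcomp Require Import ring zify.

Set Implicit Arguments.
Unset Strict Implicit.
Unset Printing Implicit Defensive.

Import Order.TTheory GRing.Theory Num.Theory.
Local Open Scope ring_scope.

(** Put Q(G) = det(x I + L(G)), so that c_k(G) is, without sign, the coefficient
of x^(n-k) in Q(G) ([lapl_coefE]). A tree is eliminated from its leaves to its
root: x I + L = U diag(a) U^T with U unitriangular, where the pivot of a vertex
of degree d is a = x + d - sum of 1/a(child), so Q is the product of the pivots
([det_lapl_tree]).

In a broom with D arms, r + 1 of whose vertices hang from the center as a path,
the pivots along this path telescope to P_(r+1), where P_0 = 1, P_1 = x + 1 and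
P_(m+2) = (x + 2) P_(m+1) - P_m. The D - 1 other arms have pivot x + 1, and
clearing the denominators of the pivot of the center gives
  (x + 1) Q = (x + 1)^(D-1) ((x^2 + (D+1) x + 1) P_(r+1) - (x + 1) P_r)
([lapl_poly_broom]). Subtracting this formula for D + 1 arms from the one for D
arms and applying the recurrence once leaves
  Q(B_(n,D)) - Q(B_(n,D+1)) = (D - 1) x (x + 1)^(D-2) (P_m - P_(m-1)),
where m = n - D - 1 ([lapl_poly_broomB]). All coefficients of the right-hand side
are nonnegative because P_(m+1) - P_m = (P_m - P_(m-1)) + x P_m
([hanging_path_polyB_over]). This is the chain of inequalities.

At the ends, the star is the broom with n - 1 arms on the nose. The path, with
its given numbering, is the broom with a single arm, and the factor D - 1
vanishes at D = 1, so this broom and the one with two arms have the same Q. *)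

(** * Laplacian coefficients as coefficients of det(x I + L) *)

Lemma eq_lapl_coef n (G H : sgraph 'I_n) k :
  adj G =2 adj H -> lapl_coef G k = lapl_coef H k.
Proof.
move=> eqGH; suff eqL : laplacian G = laplacian H by rewrite /lapl_coef eqL.
apply/matrixP => i j; rewrite !mxE eqGH; congr (Posz _ *+ _ - _).
by apply: eq_card => v; rewrite !inE eqGH.
Qed.

(** det(x I + L), the polynomial whose coefficients are the Laplacian
coefficients without signs. *)
Definition lapl_poly n (G : sgraph 'I_n) : {poly int} :=
  char_poly (- laplacian G).

(** det(x I + A) is (-1)^n times the value at -x of the characteristic polynomial
of A. *)
Lemma coef_char_polyN n (A : 'M[int]_n) i :
  (char_poly (- A))`_i = (-1) ^+ (n + i) * (char_poly A)`_i.
Proof.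
have -> : char_poly (- A) = (-1) ^+ n *: (char_poly A \Po - 'X).
  have -> : char_poly A \Po - 'X =
      \det (map_mx (comp_poly (- 'X)) (char_poly_mx A)) by rewrite det_map_mx.
  rewrite -mul_polyC rmorphXn rmorphN1 -detZ; congr (\det _).
  apply/matrixP => u v.
  rewrite !mxE rmorphB rmorphMn /= comp_polyX comp_polyC polyCN opprK.
  by rewrite mulN1r opprB mulNrn opprK addrC.
rewrite coefZ exprD -mulrA; congr (_ * _).
rewrite coef_comp_poly -[X in _ = _ * nth _ (polyseq X) _]coefK.
rewrite poly_def coef_sum mulr_sumr.
apply: eq_bigr => j _; rewrite -scaleN1r exprZn !coefZ coefXn.
by case: eqP => [->|_]; rewrite ?mulr0 // !mulr1 mulrC.
Qed.

Lemma lapl_coefE n (G : sgraph 'I_n) k : (k <= n)%N ->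
  lapl_coef G k = (lapl_poly G)`_(n - k).
Proof.
move=> le_kn; rewrite coef_char_polyN; congr (_ * _).
by rewrite -[RHS]signr_odd oddD oddB // addbA addbb signr_odd.
Qed.

(** The elimination below divides by pivots, so it takes place in the fraction
field. *)
Lemma tofrac_lapl_poly n (G : sgraph 'I_n) :
  tofrac (lapl_poly G) =
    \det ((tofrac 'X)%:M + map_mx intr (laplacian G)).
Proof.
rewrite /lapl_poly /char_poly -det_map_mx; congr (\det _); apply/matrixP=> i j.
rewrite !mxE polyCN opprK rmorphD rmorphMn /=; congr (_ + _).
by rewrite -[LHS](congr1 (fun z => tofrac z%:P) (intz _)) !rmorph_int.
Qed.

(** * Gaussian elimination on a tree *)

(** The tree is given by a parent function f that decreases indices, with root 0.
Eliminating vertices in decreasing order factors x I + L as U diag(a) U^T, where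
U is upper unitriangular with entry -1/a(j) at position (f j, j). The (i, k)
entry of this product has at most one nonzero term when i <> k, since a vertex
has only one parent. On the diagonal it is a(i) plus the sum of 1/a(j) over the
children j of i; this equals x + deg i by the recursion for a, in which each
child also contributes 1 to the degree. *)
Lemma det_lapl_tree (F : fieldType) (x : F) n (G : sgraph 'I_n)
    (f : nat -> nat) (a : nat -> F) :
    (forall i, (0 < i)%N -> (f i < i)%N) ->
    (forall i j : 'I_n,
       adj G i j = ((0 < i)%N && (j == f i :> nat))
                || ((0 < j)%N && (i == f j :> nat))) ->
    (forall i, (0 < i < n)%N -> a i != 0) ->
    (forall i, (i < n)%N ->
       a i = x + (0 < i)%N%:R
           + \sum_(j < n | (0 < j)%N && (i == f j :> nat)) (1 - (a j)^-1)) ->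
  \det (x%:M + map_mx intr (laplacian G)) = \prod_(i < n) a i.
Proof.
move=> f_lt adjE a_neq0 aE.
pose e (i j : 'I_n) := (0 < j)%N && (i == f j :> nat).
pose U : 'M[F]_n := \matrix_(i, j) ((i == j)%:R - (e i j)%:R / a j).
have e_lt i j : e i j -> (i < j)%N by case/andP=> /f_lt + /eqP->.
have detU : \det U^T = 1.
  rewrite det_trig.
    apply: big1 => i _; rewrite !mxE eqxx.
    case: (boolP (e i i)) => [/e_lt|_]; first by rewrite ltnn.
    by rewrite mul0r subr0.
  apply/is_trig_mxP => i j lt_ij; rewrite !mxE.
  case: (boolP (e j i)) => [/e_lt|_]; first by rewrite ltnNge ltnW.
  by rewrite mul0r subr0 -val_eqE /= gtn_eqF.
suff -> : x%:M + map_mx intr (laplacian G)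
    = U *m diag_mx (\row_i a i) *m U^T.
  rewrite !det_mulmx -(det_tr U) detU det_diag mul1r mulr1.
  by apply: eq_bigr => i _; rewrite mxE.
(* The neighbors of i are its parent, when i is not the root, and its children. *)
have degE i : (degree G i)%:R = (0 < i)%N%:R + \sum_(j < n | e i j) 1 :> F.
  rewrite /degree -sum1dep_card natr_sum.
  rewrite (eq_bigl (fun j => (e j i) || (e i j))) => [|j]; last exact: adjE.
  rewrite (bigID (fun j => e j i)) /=; congr (_ + _).
    rewrite (eq_bigl (fun j => e j i)) => [|j]; last first.
      by case: (e j i); rewrite ?andbF.
    have [i_gt0|] := posnP i.
      by rewrite big1 // => j /andP[]; rewrite i_gt0.
    move=> i_gt0; have fi_n : (f i < n)%N by apply: ltn_trans (f_lt _ i_gt0) _.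
    rewrite (big_pred1 (Ordinal fi_n)) // => j.
    by rewrite /e i_gt0.
  apply: eq_bigl => j.
  case: (boolP (e j i)) => [/e_lt ltji|_]; last by rewrite andbT.
  by apply/esym/negP => /e_lt; rewrite ltnNge ltnW.
have sum_delta (i : 'I_n) (c : 'I_n -> F) : \sum_j (i == j)%:R * c j = c i.
  rewrite (bigD1 i) //= eqxx mul1r big1 ?addr0 // => j /negPf ne_ji.
  by rewrite eq_sym ne_ji mul0r.
have e_neq0 i j : e i j -> a j != 0.
  by case/andP=> j_gt0 _; rewrite a_neq0 // j_gt0 ltn_ord.
apply/matrixP => i k; rewrite [RHS]mxE.
have termE j : U i j * a j * U k j
    = (i == j)%:R * ((k == j)%:R * a j - (e k j)%:R)
    - (k == j)%:R * (e i j)%:R + (e i j)%:R * (e k j)%:R / a j.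
  rewrite !mxE.
  have [/e_neq0 aj|nij] := boolP (e i j);
    have [/e_neq0 aj'|nkj] := boolP (e k j);
    rewrite /= ?mul0r ?mulr0 ?mul0r; first [ring | by field].
transitivity (\sum_j U i j * a j * U k j); last first.
  by apply: eq_bigr => j _; rewrite mul_mx_diag !mxE.
rewrite (eq_bigr _ (fun j _ => termE j)) big_split sumrB /= !sum_delta !mxE.
rewrite rmorphB rmorphMn /= adjE -/(e k i) -/(e i k).
have [<-{k termE}|ne_ik] := eqVneq i k.
  have eii : e i i = false by apply/negP=> /e_lt; rewrite ltnn.
  rewrite eii !mulr1n mul1r !subr0 -[(degree G i)%:~R]/((degree G i)%:R).
  rewrite degE aE //.
  rewrite sumrB /=; have -> : \sum_j (e i j)%:R * (e i j)%:R / a j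
      = \sum_(j < n | e i j) (a j)^-1.
    rewrite [RHS]big_mkcond; apply: eq_bigr => j _.
    by case: (e i j); rewrite ?mul0r // !mul1r.
  by rewrite -[RHS]addrA subrK addrA.
rewrite [\sum_j _]big1 => [|j _].
  rewrite !mulr0n mul0r !add0r addr0 -opprD; congr (- _).
  have [/e_lt lt_ki|_] := boolP (e k i); have [/e_lt lt_ik|_] := boolP (e i k);
    rewrite /= ?addr0 ?add0r //.
  by have := ltn_trans lt_ki lt_ik; rewrite ltnn.
(* A common child j of i and k would have two parents. *)
have [/andP[_ /eqP eij]|_] := boolP (e i j); last by rewrite !mul0r.
have [/andP[_ /eqP ekj]|_] := boolP (e k j); last by rewrite mulr0 mul0r.
by case/eqP: ne_ik; apply: val_inj; rewrite /= eij.
Qed.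

(** * The polynomial of a hanging path *)

(** The determinant of x I + L restricted to m vertices that form a path hanging
by one end from the rest of the graph. In the whole graph these vertices have
degree 2, except the free end, which has degree 1. *)
Fixpoint hanging_path_poly (m : nat) : {poly int} :=
  match m with
  | 0 => 1
  | 1 => 'X + 1
  | (m'.+1 as m1).+1 => ('X + 2%:R) * hanging_path_poly m1 - hanging_path_poly m'
  end.

Lemma hanging_path_polySS m :
  hanging_path_poly m.+2
    = ('X + 2%:R) * hanging_path_poly m.+1 - hanging_path_poly m.
Proof. by []. Qed.

(** The constant coefficient is 1. *)
Lemma hanging_path_poly_neq0 m : hanging_path_poly m != 0.
Proof.
suff [P0 _] : (hanging_path_poly m).[0] = 1 /\ (hanging_path_poly m.+1).[0] = 1.
  by apply: contra_eq_neq P0 => ->; rewrite horner0 eq_sym oner_neq0.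
elim: m => [|m [P0 P1]]; first by rewrite /= !hornerE.
by rewrite hanging_path_polySS !hornerE P0 P1.
Qed.

(** The recurrence reads P_(m+2) - P_(m+1) = (P_(m+1) - P_m) + x P_(m+1), so that
P_m and its successive differences are built from 1 and x without subtraction.
*)
Lemma hanging_path_polyB_over (S : semiringClosed int) m :
  hanging_path_poly m.+1 - hanging_path_poly m \is a polyOver S.
Proof.
suff [] : hanging_path_poly m.+1 - hanging_path_poly m \is a polyOver S
      /\ hanging_path_poly m.+1 \is a polyOver S by [].
elim: m => [|m [dP P]].
  rewrite addrK; split; first exact: polyOverX.
  by rewrite /=; apply: rpredD; [exact: polyOverX|exact: rpred1].
have dP' : hanging_path_poly m.+2 - hanging_path_poly m.+1 \is a polyOver S.
  have -> : hanging_path_poly m.+2 - hanging_path_poly m.+1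
      = (hanging_path_poly m.+1 - hanging_path_poly m)
        + 'X * hanging_path_poly m.+1.
    rewrite hanging_path_polySS; ring.
  by apply: rpredD => //; apply: rpredM => //; exact: polyOverX.
split=> //; rewrite -[hanging_path_poly m.+2](subrK (hanging_path_poly m.+1)).
exact: rpredD.
Qed.

(** * The polynomial of a broom *)

(** Rooted at the center, the broom is a tree whose numbering increases away from
the root. *)
Definition broom_parent (D p j : nat) : nat :=
  if (j <= D)%N then 0 else if j == D.+1 then p.+1 else j.-1.

Lemma broom_parent_lt D (p : 'I_D) j : (0 < j)%N -> (broom_parent D p j < j)%N.
Proof.
move: (ltn_ord p); rewrite /broom_parent.
by case: (leqP j D) => ?; [|case: eqP => ?]; lia.
Qed.

Lemma adj_broom n D (p : 'I_D) (i j : 'I_n) :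
  adj (broom n p) i j = ((0 < i)%N && (j == broom_parent D p i :> nat))
                     || ((0 < j)%N && (i == broom_parent D p j :> nat)).
Proof.
have p_lt := ltn_ord p; rewrite /= /sym_adj -val_eqE /broom_parent /=.
case: i j => [i ?] [j ?] /=.
case: (leqP i D); case: (leqP j D); case: (i =P D.+1); case: (j =P D.+1);
  by lia.
Qed.

(** The pivots are x + 1 at the D - 1 pendent arms, P_(t+1) / P_t at the vertex of
the hanging path with t vertices beyond it, and [a0] at the center, which sees
the pendent arms and the hanging path of r + 1 vertices. The factor x + 1 on the
left clears the denominator that the pendent arms leave in [a0], with no case
distinction at D = 1. *)
Lemma det_lapl_broom (F : fieldType) (x : F) (P : nat -> F) D r (p : 'I_D) :
    P 0 = 1 -> P 1 = x + 1 ->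
    (forall m, P m.+2 = (x + 2%:R) * P m.+1 - P m) ->
    (forall m, P m != 0) ->
  (x + 1) * \det (x%:M + map_mx intr (laplacian (broom (D + r).+1 p)))
    = (x + 1) ^+ D.-1 *
      ((x ^+ 2 + D.+1%:R * x + 1) * P r.+1 - (x + 1) * P r).
Proof.
move=> P0 P1 PSS P_neq0.
have x1_neq0 : x + 1 != 0 by rewrite -P1.
pose n := (D + r).+1.
pose a0 : F := x + D.-1%:R * (1 - (x + 1)^-1) + (1 - P r / P r.+1).
pose a (i : nat) : F :=
  if i == 0 then a0 else if i == p.+1 then P r.+1 / P r
  else if (i <= D)%N then x + 1 else P (n - i)%N / P (n - i).-1%N.
have aS (i : 'I_D) : a i.+1 = if i == p then P r.+1 / P r else x + 1.
  by rewrite /a eqSS ltn_ord.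
have aD i : (D < i)%N -> a i = P (n - i)%N / P (n - i).-1%N.
  move=> lt_Di; have lt_pD := ltn_ord p.
  by rewrite /a leqNgt lt_Di !gtn_eqF //; lia.
have D_gt0 : (0 < D)%N by apply: leq_ltn_trans (ltn_ord p).
have a_neq0 i : (0 < i < n)%N -> a i != 0.
  rewrite /a => /andP[i_gt0 lt_in].
  by rewrite gtn_eqF //; do 2?[case: ifP => _]; rewrite ?mulf_neq0 ?invr_neq0.
(* At m = 0 the predecessor is truncated and the last summand vanishes, as it
   must for a vertex without children. *)
have Pratio m : P m.+1 / P m = x + 1 + (1 - P m.-1 / P m).
  case: m => [|m]; first by rewrite /= P1 P0 invr1 !mulr1 subrr addr0.
  by rewrite PSS; field; exact: P_neq0.
(* Taking c = n states that i has no child; both sides are then 0. *)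
have sum1 i c : (D < c <= n)%N ->
    (forall j, (j < n)%N ->
       (0 < j)%N && (i == broom_parent D p j :> nat) = (j == c)) ->
    \sum_(j < n | (0 < j)%N && (i == broom_parent D p j :> nat))
       (1 - (a j)^-1) = 1 - P (n - c).-1%N / P (n - c)%N.
  move=> /andP[lt_Dc le_cn] childE.
  rewrite (eq_bigl (fun j : 'I_n => val j == c)) => [|j]; last exact: childE.
  move: le_cn; rewrite leq_eqVlt => /predU1P[->|lt_cn].
    rewrite subnn divff // subrr big_pred0 // => j.
    by rewrite ltn_eqF // ltn_ord.
  by rewrite (big_pred1 (Ordinal lt_cn)) //= aD // invf_div.
have sum0 :
    \sum_(j < n | (0 < j)%N && (0 == broom_parent D p j :> nat))
       (1 - (a j)^-1) = D.-1%:R * (1 - (x + 1)^-1) + (1 - P r / P r.+1).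
  rewrite big_mkcond big_ord_recl /= add0r big_split_ord /= [X in _ + X]big1.
    rewrite addr0 (bigD1 p) //= addrC; congr (_ + _).
      transitivity (\sum_(i < D | i != p) (1 - (x + 1)^-1)).
        apply: eq_bigr => i /negPf ne_ip.
        by rewrite /broom_parent ltn_ord aS ne_ip.
      by rewrite sumr_const cardC1 card_ord mulr_natl.
    by rewrite /broom_parent ltn_ord aS !eqxx invf_div.
  move=> i _; rewrite ifF // /broom_parent /bump leq0n add1n ltnNge leq_addr /=.
  by case: (_ == D.+1); lia.
have aE i : (i < n)%N ->
  a i = x + (0 < i)%N%:R
      + \sum_(j < n | (0 < j)%N && (i == broom_parent D p j :> nat))
           (1 - (a j)^-1).
  move=> lt_in; have lt_pD := ltn_ord p.
  have [->|i_gt0] := posnP i; first by rewrite sum0 /a eqxx /a0 addr0 -addrA.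
  have childE j : (0 < j)%N && (i == broom_parent D p j :> nat)
      = (D < j)%N && (i == if j == D.+1 then p.+1 else j.-1 :> nat).
    rewrite /broom_parent; case: (leqP j D) => [_|lt_Dj].
      by rewrite (gtn_eqF i_gt0) andbF.
    by rewrite (leq_ltn_trans _ lt_Dj).
  have [lt_Di|le_iD] := ltnP D i.
    rewrite (sum1 i i.+1) ?aD //; first last.
    - by move=> j _; rewrite childE; case: (j =P D.+1); lia.
    - lia.
    have -> : (n - i = (n - i.+1).+1)%N by lia.
    by rewrite Pratio.
  have [i_p|ne_ip] := eqVneq i p.+1.
    rewrite (sum1 i D.+1) //; first last.
    - by move=> j _; rewrite childE; case: (j =P D.+1); lia.
    - lia.
    have -> : (n - D.+1 = r)%N by rewrite /n subSS addKn.
    by rewrite /a i_p eqxx Pratio.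
  rewrite (sum1 i n) //; first last.
  - by move=> j lt_jn; rewrite childE; case: (j =P D.+1); lia.
  - by rewrite /n; lia.
  by rewrite subnn P0 invr1 mulr1 subrr addr0 /a gtn_eqF // (negPf ne_ip) le_iD.
have prodP : \prod_(i < r) a (D.+1 + i)%N = P r.
  rewrite (eq_bigr (fun i : 'I_r => P (r - i)%N / P (r - i).-1)) => [|i _].
    elim: (r) => [|r' IH]; first by rewrite big_ord0 P0.
    by rewrite big_ord_recl /= IH subn0 divfK.
  by rewrite aD ?ltnS ?leq_addr //; congr (P _ / P _); rewrite /n; lia.
rewrite (det_lapl_tree (@broom_parent_lt D p) (adj_broom p) a_neq0 aE).
rewrite big_ord_recl big_split_ord /= -/(a 0%N) prodP.
have -> : \prod_(i < D) a (bump 0 i) = P r.+1 / P r * (x + 1) ^+ D.-1.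
  rewrite (bigD1 p) //= aS eqxx; congr (_ * _).
  transitivity (\prod_(i < D | i != p) (x + 1)); last first.
    by rewrite prodr_const cardC1 card_ord.
  by apply: eq_bigr => i /negPf ne_ip; rewrite aS ne_ip.
have -> : D.+1%:R = D.-1%:R + 2%:R :> F by rewrite -natrD addn2 prednK.
rewrite /a eqxx /a0; field.
by rewrite x1_neq0 !P_neq0.
Qed.

Lemma lapl_poly_broom n D (p : 'I_D) : (D < n)%N ->
  ('X + 1) * lapl_poly (broom n p)
    = ('X + 1) ^+ D.-1 *
      (('X ^+ 2 + D.+1%:R * 'X + 1) * hanging_path_poly (n - D)
       - ('X + 1) * hanging_path_poly (n - D).-1).
Proof.
move=> lt_Dn; set r := (n - D).-1.
have -> : (n - D = r.+1)%N by rewrite /r; lia.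
have -> : n = (D + r).+1 by rewrite /r; lia.
apply/eqP; rewrite -tofrac_eq; apply/eqP.
rewrite rmorphM /= tofrac_lapl_poly rmorphD rmorph1.
rewrite (@det_lapl_broom _ _ (fun m => tofrac (hanging_path_poly m))) => [||||m].
- by rewrite !(rmorphM, rmorphXn, rmorphB, rmorphD, rmorph1, rmorph_nat).
- by rewrite rmorph1.
- by rewrite rmorphD rmorph1.
- by move=> m; rewrite hanging_path_polySS rmorphB rmorphM rmorphD rmorph_nat.
- by rewrite tofrac_eq0 hanging_path_poly_neq0.
Qed.

(** * Comparison of consecutive brooms *)

(** Both brooms have the same n, so passing from D + 1 to D arms lengthens the
hanging path by one vertex. *)
Lemma lapl_poly_broomB n D (p : 'I_D.+1) (q : 'I_D) : (D.+1 < n)%N ->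
  lapl_poly (broom n q) - lapl_poly (broom n p)
    = D.-1%:R * 'X * ('X + 1) ^+ D.-2 *
      (hanging_path_poly (n - D.+1) - hanging_path_poly (n - D.+1).-1).
Proof.
move=> lt_Dn; set m := (n - D.+1).-1.
have X1_neq0 : 'X + 1 != 0 :> {poly int} := hanging_path_poly_neq0 1.
apply: (mulfI X1_neq0).
rewrite mulrBr !lapl_poly_broom // 1?ltnW //.
have -> : (n - D.+1 = m.+1)%N by rewrite /m; lia.
have -> : (n - D = m.+2)%N by rewrite /m; lia.
rewrite hanging_path_polySS -pred_Sn.
move: (hanging_path_poly m.+1) (hanging_path_poly m) => P1 P0.
(* For D = 1 both sides are 0; the truncated exponent is then harmless. *)
case: D q {p lt_Dn m} => [[]//|[|D] _] /=; first by rewrite expr0; ring.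
by rewrite -!natr1 !exprS; ring.
Qed.

Lemma lapl_poly_broomB_over (S : semiringClosed int) n D
    (p : 'I_D.+1) (q : 'I_D) : (D.+1 < n)%N ->
  lapl_poly (broom n q) - lapl_poly (broom n p) \is a polyOver S.
Proof.
move=> lt_Dn; rewrite lapl_poly_broomB //.
have -> : (n - D.+1 = (n - D.+1).-1.+1)%N by lia.
rewrite -pred_Sn; apply: rpredM; last exact: hanging_path_polyB_over.
have X_S : 'X \is a polyOver S by exact: polyOverX.
by rewrite !rpredM ?rpredX ?rpredD ?rpred_nat ?rpred1.
Qed.

(** * The star and the path as brooms *)

Lemma eq_adj_star_broom n (p : 'I_n.-1) : adj (star n) =2 adj (broom n p).
Proof.
have lt_p := ltn_ord p.
by move=> [i lt_i] [j lt_j]; rewrite /= /sym_adj -val_eqE /=; lia.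
Qed.

Lemma eq_adj_path_broom n (q : 'I_1) : adj (path_graph n) =2 adj (broom n q).
Proof.
have lt_q := ltn_ord q.
by move=> [i lt_i] [j lt_j]; rewrite /= /sym_adj -val_eqE /=; lia.
Qed.

(** * The chain of inequalities *)

Theorem mainTheorem4 (n k : nat) (hn : (3 <= n)%N) (hk : (k <= n)%N) :
  [/\ forall p : 'I_n.-1,
        lapl_coef (star n) k = lapl_coef (broom n p) k,
      forall (D : nat) (p : 'I_D.+1) (q : 'I_D),
        (2 <= D)%N -> (D.+1 <= n.-1)%N ->
        lapl_coef (broom n p) k <= lapl_coef (broom n q) k
    & forall p : 'I_2,
        lapl_coef (broom n p) k = lapl_coef (path_graph n) k].
Proof.
split=> [p|D p q D_ge2 le_Dn|p].
- exact/eq_lapl_coef/eq_adj_star_broom.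
- rewrite (lapl_coefE (broom n p) hk) (lapl_coefE (broom n q) hk).
  rewrite -subr_ge0 -coefB.
  have /polyOverP/(_ (n - k)%N) :
      lapl_poly (broom n q) - lapl_poly (broom n p) \is a polyOver Num.nneg.
    by apply: lapl_poly_broomB_over; lia.
  by [].
- transitivity (lapl_coef (broom n (ord0 : 'I_1)) k); last first.
    by symmetry; apply/eq_lapl_coef/eq_adj_path_broom.
  rewrite (lapl_coefE (broom n p) hk) (lapl_coefE (broom n _) hk).
  apply/esym/eqP; rewrite -subr_eq0 -coefB lapl_poly_broomB; last by lia.
  by rewrite !mul0r coef0.
Qed.
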